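(* Let $M=\operatorname{End}(\mathbb{Q},\leqslant)$ be the endomorphism monoid of the ordered set of rational numbers. (i) Let $\Omega$ be a countable linearly ordered set. Then there exist $2^{\aleph_0}$ distinct regular $\mathscr{D}$-classes of $M$ whose group $\mathscr{H}$-classes are isomorphic to $\operatorname{Aut}\Omega$. (ii) There is exactly one countable regular $\mathscr{D}$-class $D_0$ of $M$. This $D_0$ consists of the (idempotent) endomorphisms with image of cardinality $1$, and every $\mathscr{H}$-class in $D_0$ is a group $\mathscr{H}$-class isomorphic to the trivial group. Every other regular $\mathscr{D}$-class of $M$ contains $2^{\aleph_0}$ distinct group $\mathscr{H}$-classes.
   Context: Linearly ordered sets are non-empty; ''countable'' means finite or countably infinite. $\operatorname{End}(\mathbb{Q},\leqslant)$ is the monoid, under composition, of all maps $f\colon\mathbb{Q}\to\mathbb{Q}$ such that $u\leqslant v$ implies $uf\leqslant vf$. Maps are written on the right, so $fg$ means first $f$, then $g$. $\operatorname{Aut}\Omega$ is the group of order-automorphisms of $\Omega$. Green's relations on a monoid $M$: $f\,\mathscr{L}\,g$ iff $Mf=Mg$; $f\,\mathscr{R}\,g$ iff $fM=gM$; $\mathscr{H}=\mathscr{L}\cap\mathscr{R}$; $\mathscr{D}=\mathscr{L}\circ\mathscr{R}$ (an equivalence relation). An element $f\in M$ is regular if $fgf=f$ for some $g\in M$. A $\mathscr{D}$-class containing a regular element consists entirely of regular elements and is called regular. A group $\mathscr{H}$-class is the $\mathscr{H}$-class of an idempotent; it is a subgroup of $M$ (a maximal subgroup) with that idempotent as identity.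 *)

(* Defs.v *)
From HB Require Import structures.
From mathcomp Require Import all_boot all_order all_algebra.
From mathcomp Require Import boolp classical_sets functions cardinality.

Set Implicit Arguments.
Unset Strict Implicit.
Unset Printing Implicit Defensive.

Import Order.TTheory.

Local Open Scope classical_set_scope.
Local Open Scope group_scope.

Section Green.
Variable M : monoidType.
Implicit Types (f g e : M) (C : set M) (G : groupType).

Definition greenL f g := range (fun m => m * f) = range (fun m => m * g).
Definition greenR f g := range (fun m => f * m) = range (fun m => g * m).
Definition greenH f g := greenL f g /\ greenR f g.
Definition greenD f g := exists h, greenL f h /\ greenR h g.

Definition regular f := exists g, f * g * f = f.

Definition Hclass C := exists f, C = [set g | greenH f g].
Definition Dclass C := exists f, C = [set g | greenD f g].
Definition regular_Dclass C := Dclass C /\ exists2 f, C f & regular f.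
Definition group_Hclass C := exists2 e, e * e = e & C = [set g | greenH e g].

(* The subset C, with the multiplication inherited from M, is a group
   isomorphic to G; the identity of C need not be that of M. *)
Definition isomorphic_to C G :=
  exists phi : {multiplicative G -> M}, set_bij [set: G] C phi.

End Green.

Section OrderEndo.
Context {d : Order.disp_t} {T : porderType d}.
Implicit Types f g h : {omorphism T -> T}.

Lemma omorphism_ext f g : f =1 g -> f = g.
Proof.
case: f => f [[fle]]; case: g => g [[gle]] /= /funext fg.
by case: _ / fg in gle *; rewrite (Prop_irrelevance fle gle).
Qed.

HB.instance Definition _ := gen_eqMixin {omorphism T -> T}.
HB.instance Definition _ := gen_choiceMixin {omorphism T -> T}.

(* Maps act on the right: the product f * g is "first f, then g". *)
Definition omorphism_one : {omorphism T -> T} := idfun.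
Definition omorphism_mul f g : {omorphism T -> T} := g \o f.

Fact omorphism_mulA : associative omorphism_mul.
Proof. by move=> f g h; exact: omorphism_ext. Qed.
Fact omorphism_mul1g : left_id omorphism_one omorphism_mul.
Proof. by move=> f; exact: omorphism_ext. Qed.
Fact omorphism_mulg1 : right_id omorphism_one omorphism_mul.
Proof. by move=> f; exact: omorphism_ext. Qed.

HB.instance Definition _ := isMonoid.Build {omorphism T -> T}
  omorphism_mulA omorphism_mul1g omorphism_mulg1.

End OrderEndo.

Section OrderAut.
Context {d : Order.disp_t} (T : porderType d).

Record orderAut := OrderAut {
  orderAut_fun :> T -> T;
  orderAut_bij : bijective orderAut_fun;
  orderAut_mono : {mono orderAut_fun : x y / (x <= y)%O}
}.
Implicit Types f g h : orderAut.

Lemma orderAut_ext f g : f =1 g -> f = g.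
Proof.
case: f => f fb fm; case: g => g gb gm /= /funext fg.
case: _ / fg in gb gm *.
by rewrite (Prop_irrelevance fb gb) (Prop_irrelevance fm gm).
Qed.

HB.instance Definition _ := gen_eqMixin orderAut.
HB.instance Definition _ := gen_choiceMixin orderAut.

Definition orderAut_one : orderAut :=
  @OrderAut idfun (Bijective (fun=> erefl) (fun=> erefl)) (fun _ _ => erefl).

Definition orderAut_mul f g : orderAut :=
  @OrderAut (g \o f) (bij_comp (orderAut_bij g) (orderAut_bij f))
    (fun x y => etrans (orderAut_mono g (f x) (f y)) (orderAut_mono f x y)).

Fact orderAut_inv_subproof f : exists g : T -> T, cancel f g /\ cancel g f.
Proof. by case: (orderAut_bij f) => g fK gK; exists g. Qed.

Definition orderAut_invfun f : T -> T := sval (cid (orderAut_inv_subproof f)).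

Fact orderAut_invfunK f : cancel f (orderAut_invfun f).
Proof. by rewrite /orderAut_invfun; case: cid => g []. Qed.
Fact orderAut_funK f : cancel (orderAut_invfun f) f.
Proof. by rewrite /orderAut_invfun; case: cid => g []. Qed.

Fact orderAut_inv_mono f : {mono orderAut_invfun f : x y / (x <= y)%O}.
Proof. by move=> x y; rewrite -(orderAut_mono f) !orderAut_funK. Qed.

Definition orderAut_inv f : orderAut :=
  @OrderAut (orderAut_invfun f)
    (Bijective (@orderAut_funK f) (@orderAut_invfunK f)) (@orderAut_inv_mono f).

Fact orderAut_mulA : associative orderAut_mul.
Proof. by move=> f g h; exact: orderAut_ext. Qed.
Fact orderAut_mul1g : left_id orderAut_one orderAut_mul.
Proof. by move=> f; exact: orderAut_ext. Qed.
Fact orderAut_mulg1 : right_id orderAut_one orderAut_mul.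
Proof. by move=> f; exact: orderAut_ext. Qed.
Fact orderAut_mulVg : left_inverse orderAut_one orderAut_inv orderAut_mul.
Proof. by move=> f; apply: orderAut_ext; exact: orderAut_funK. Qed.
Fact orderAut_mulgV : right_inverse orderAut_one orderAut_inv orderAut_mul.
Proof. by move=> f; apply: orderAut_ext; exact: orderAut_invfunK. Qed.

HB.instance Definition _ := isGroup.Build orderAut
  orderAut_mulA orderAut_mul1g orderAut_mulg1 orderAut_mulVg orderAut_mulgV.

End OrderAut.

Section TrivialGroup.

Definition unit_mul (_ _ : unit) := tt.

Fact unit_mulA : associative unit_mul. Proof. by []. Qed.
Fact unit_mul1g : left_id tt unit_mul. Proof. by case. Qed.
Fact unit_mulg1 : right_id tt unit_mul. Proof. by case. Qed.
Fact unit_mulVg : left_inverse tt id unit_mul. Proof. by []. Qed.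
Fact unit_mulgV : right_inverse tt id unit_mul. Proof. by []. Qed.

HB.instance Definition _ := isGroup.Build unit
  unit_mulA unit_mul1g unit_mulg1 unit_mulVg unit_mulgV.

End TrivialGroup.

(* Main.v *)
(* An idempotent e of End(Q) is determined up to D-equivalence by the order type
   X of its image, and its H-class is Aut(X). Every countable order X is
   obtained: a back-and-forth argument gives a monotone surjection r of Q onto
   X, and e is r followed by a section of r. If X has points a < b, one can
   moreover require r 0 = a and r q <= a exactly for q in a prescribed irrational
   cut of Q; taking a section with a |-> 0, the cut is {q | e q <= 0}, hence
   there are continuum many idempotents with image of type X.

   For the first part take X to be a dense sum of finite blocks with pairwise
   distinct lengths, followed by Omega with each point replaced by a copy of the
   natural numbers. An isomorphism between two such orders preserves the
   covering relation, hence the blocks and the position of a point in its block,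
   so it fixes the finite blocks pointwise and is induced by an automorphism of
   Omega; a binary sequence is encoded in the set of block lengths. *)
Require Import Defs.
From HB Require Import structures.
From mathcomp Require Import all_boot all_order all_algebra.
From mathcomp Require Import boolp classical_sets functions cardinality.
From mathcomp Require Import zify lra.

Set Implicit Arguments.
Unset Strict Implicit.
Unset Printing Implicit Defensive.

Import Order.TTheory GRing.Theory Num.Theory.

(** * Green's relations in an arbitrary monoid *)

Section GreenRelations.
Local Open Scope classical_set_scope.
Local Open Scope group_scope.
Variable M : monoidType.
Implicit Types (f g h e : M).

Lemma greenLP f g :
  greenL f g <-> (exists a, f = a * g) /\ exists b, g = b * f.
Proof.
split=> [fg|[[a fE] [b gE]]].
  move/seteqP: fg => [/(_ f)fg /(_ g)gf]; split.
    by have [|a _ <-] := fg; [exists 1; rewrite ?mul1g | exists a].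
  by have [|a _ <-] := gf; [exists 1; rewrite ?mul1g | exists a].
by apply/seteqP; split=> _ [m _ <-]; [exists (m * a) | exists (m * b)];
  rewrite // -mulgA -?fE -?gE.
Qed.

Lemma greenRP f g :
  greenR f g <-> (exists a, f = g * a) /\ exists b, g = f * b.
Proof.
split=> [fg|[[a fE] [b gE]]].
  move/seteqP: fg => [/(_ f)fg /(_ g)gf]; split.
    by have [|a _ <-] := fg; [exists 1; rewrite ?mulg1 | exists a].
  by have [|a _ <-] := gf; [exists 1; rewrite ?mulg1 | exists a].
by apply/seteqP; split=> _ [m _ <-]; [exists (a * m) | exists (b * m)];
  rewrite // mulgA -?fE -?gE.
Qed.

(** If [h = c * g], then [c * f] is the required element: a left factor that undoes [c] on [g] also
    undoes it on [f], a right multiple of [g]. This commutation makes [greenD] an equivalence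
    relation. *)
Lemma greenRL f g h : greenR f g -> greenL g h -> exists k, greenL f k /\ greenR k h.
Proof.
move=> /greenRP[[a fE] [b gE]] /greenLP[[d gE'] [c hE]].
exists (c * f); split; [apply/greenLP | apply/greenRP]; split.
- by exists d; rewrite {2}fE (mulgA c) -hE mulgA -gE'.
- by exists c.
- by exists a; rewrite hE -mulgA -fE.
- by exists b; rewrite hE {1}gE mulgA.
Qed.

Lemma greenD_refl f : greenD f f.
Proof. by exists f. Qed.

Lemma greenD_sym f g : greenD f g -> greenD g f.
Proof. by move=> [h [fh hg]]; apply: (@greenRL g h f); symmetry. Qed.

Lemma greenD_trans f g h : greenD f g -> greenD g h -> greenD f h.
Proof.
move=> [u [fu ug]] [v [gv vh]]; have [w [uw wv]] := greenRL ug gv.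
by exists w; split; [rewrite /greenL fu | rewrite /greenR wv].
Qed.

Lemma greenHD f g : greenH f g -> greenD f g.
Proof. by move=> [L R]; exists g. Qed.

Lemma Dclass_eq (D : set M) f g : Dclass D -> D f -> D g <-> greenD f g.
Proof.
move=> [d ->] df; split=> [dg|]; last exact: greenD_trans.
exact: greenD_trans (greenD_sym df) dg.
Qed.

(* If f g f = f then f is R-related to the idempotent f g. *)
Lemma regular_Dclass_idem (D : set M) :
  regular_Dclass D -> exists e, [/\ D e, e * e = e & D = [set g | greenD e g]].
Proof.
move=> [Dc [f Df [g fgf]]].
have De : D (f * g).
  apply/(Dclass_eq _ Dc Df); exists f; split=> //; apply/greenRP.
  by split; [exists f; rewrite fgf | exists g].
exists (f * g); split=> //; first by rewrite mulgA fgf.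
by apply/seteqP; split=> h; rewrite (Dclass_eq h Dc De).
Qed.

(** The pair [x], [y] is an isomorphism between the idempotents in the Karoubi envelope of [M]; this
    form can be transported through splittings. *)
Lemma greenD_idemP e e' : e * e = e -> e' * e' = e' ->
  greenD e e' <-> exists x y, [/\ x * y = e, y * x = e', e * x = x & y * e = y].
Proof.
move=> ee ee'; split=> [[h [/greenLP[[a eE] [b hE]] /greenRP[[c hE'] [d eE']]]]|].
  have he : h * e = h by rewrite hE -mulgA ee.
  have e'h : e' * h = h by rewrite hE' mulgA ee'.
  exists (e * d), h; split=> //.
  - by rewrite {1}eE -2!mulgA (mulgA h d) -eE' e'h.
  - by rewrite mulgA he -eE'.
  - by rewrite mulgA ee.
move=> [x [y [xy yx ex ye]]].
exists y; split; [apply/greenLP | apply/greenRP]; split.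
- by exists x.
- by exists y.
- by exists y; rewrite -yx -mulgA xy ye.
- by exists x.
Qed.

(** The H-class of [e] is the unit group of the local monoid [eMe]. *)
Lemma greenH_idemP e f : e * e = e ->
  greenH e f <-> [/\ e * f = f, f * e = f & exists g, f * g = e /\ g * f = e].
Proof.
move=> ee; split=> [[/greenLP[[m eE] [n fE]] /greenRP[[m' eE'] [n' fE']]]|].
  have ef : e * f = f by rewrite fE' mulgA ee.
  have fe : f * e = f by rewrite fE -mulgA ee.
  split=> //; exists (e * m'); split; first by rewrite mulgA fe.
  by rewrite {1}eE -(mulgA m) -eE' -mulgA ef.
move=> [ef fe [g [fg gf]]].
split; [apply/greenLP | apply/greenRP]; split.
- by exists g.
- by exists f; rewrite fe.
- by exists g.
- by exists f; rewrite ef.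
Qed.

(** Each idempotent is an identity for the other. Group H-classes can therefore be counted by their
    idempotents. *)
Lemma greenH_idem_eq e e' : e * e = e -> e' * e' = e' -> greenH e e' -> e = e'.
Proof.
move=> ee ee' /(greenH_idemP _ ee)[ee'1 e'e [g [e'g _]]].
have : e' * e = e by rewrite -e'g mulgA ee'.
by rewrite e'e.
Qed.

Lemma Hclass_eq e g : greenH e g -> [set h | greenH e h] = [set h | greenH g h].
Proof.
move=> [l r]; apply/seteqP; split=> h [l' r'].
  by split; [exact: etrans (esym l) l' | exact: etrans (esym r) r'].
by split; [exact: etrans l l' | exact: etrans r r'].
Qed.

Lemma Hclass_subset (D : set M) e : Dclass D -> D e ->
  [set g | greenH e g] `<=` D.
Proof. by move=> Dc De g /greenHD eg; apply/(Dclass_eq g Dc De). Qed.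

End GreenRelations.

(** * Continuum many irrational cuts of the rationals *)

Section IrrationalCuts.
Local Open Scope classical_set_scope.
Local Open Scope ring_scope.
Implicit Types (C : set rat) (p q : rat) (s t : nat -> bool).

(** The last two clauses exclude a rational endpoint; they leave room next to the cut for inserting
    new points on a prescribed side. The point 0 is kept in [C] because it will be mapped to [a]. *)
Definition irrational_cut C :=
  [/\ C 0, exists q, ~ C q, forall p q, p <= q -> C q -> C p,
      forall q, C q -> exists2 p, q < p & C p
    & forall q, ~ C q -> exists2 p, p < q & ~ C p].

(* A ninth of the interval I lying strictly inside it, left or right of its
   midpoint according to b, and avoiding q. *)
Definition subinterval (b : bool) q (I : rat * rat) : rat * rat :=
  let w := (I.2 - I.1) / 9%:R in
  let c := I.1 + (if b then 5%:R else 1) * w in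
  let l := if q <= c + w then c + 2%:R * w else c in
  (l, l + w).

(* The n-th rational is discarded at stage n, so the limit point is irrational. *)
Fixpoint nested s n : rat * rat :=
  if n is m.+1 then subinterval (s m) (odflt 0 (unpickle m)) (nested s m)
  else (1, 2%:R).

Definition cut_of s : set rat := [set q | exists n, q < (nested s n).1].

(** Measured from [I.1] in units of [w], the candidates are [1,2] and [3,4] for [b] false, [5,6] and
    [7,8] for [b] true, while the midpoint is 4.5. Of the two disjoint candidates on a side, the one
    chosen misses [q]. *)
Lemma subintervalP b q I : I.1 < I.2 ->
  let J := subinterval b q I in
  [/\ J.1 < J.2, I.1 < J.1, J.2 < I.2, q < J.1 \/ J.2 < q &
      if b then (I.1 + I.2) / 2%:R < J.1 else J.2 < (I.1 + I.2) / 2%:R].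
Proof.
case: I => l r /= lr; rewrite /subinterval /=.
set w := (r - l) / 9%:R; have w0 : 0 < w by rewrite /w; lra.
have rE : r = l + 9%:R * w by rewrite /w; lra.
rewrite {}rE; clearbody w; clear lr.
by case: b; case: ifPn; rewrite -?ltNge => qc; split; lra.
Qed.

Lemma nested_lt s n : (nested s n).1 < (nested s n).2.
Proof.
elim: n => [|n IHn] //=.
by have [] := subintervalP (s n) (odflt 0 (unpickle n)) IHn.
Qed.

Lemma nested_le s m n : (m <= n)%N ->
  (nested s m).1 <= (nested s n).1 /\ (nested s n).2 <= (nested s m).2.
Proof.
elim: n => [|n IHn]; first by rewrite leqn0 => /eqP->.
rewrite leq_eqVlt => /predU1P[->//|/IHn[l r]].
have [_ l' r' _ _] := subintervalP (s n) (odflt 0 (unpickle n)) (nested_lt s n).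
by split; [exact: le_trans l (ltW l') | exact: le_trans (ltW r') r].
Qed.

(** The stage indexed by [pickle q] puts [q] strictly to one side of the interval, and later
    intervals only shrink. *)
Lemma cut_ofPn s q : ~ cut_of s q <-> exists n, (nested s n).2 < q.
Proof.
split=> [nC|[n rq] [m ql]].
  have := subintervalP (s (pickle q)) q (nested_lt s (pickle q)).
  set J := subinterval _ _ _ => -[_ _ _ qJ _].
  have JE : J = nested s (pickle q).+1 by rewrite /= pickleK.
  exists (pickle q).+1; rewrite -JE; case: qJ => // qJ; case: nC.
  by exists (pickle q).+1; rewrite -JE.
have [l _] := nested_le s (leq_maxr n m); have [_ r] := nested_le s (leq_maxl n m).
have := nested_lt s (maxn n m); lra.
Qed.

Lemma cut_of_irrational s : irrational_cut (cut_of s).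
Proof.
split.
- by exists 0%N.
- exists 3%:R; apply/cut_ofPn; exists 0%N => /=; lra.
- by move=> p q pq [n qn]; exists n; exact: le_lt_trans qn.
- move=> q [n qn]; exists (nested s n).1 => //; exists n.+1.
  by have [] := subintervalP (s n) (odflt 0 (unpickle n)) (nested_lt s n).
- move=> q /cut_ofPn[n nq]; exists (nested s n).2 => //; apply/cut_ofPn; exists n.+1.
  by have [] := subintervalP (s n) (odflt 0 (unpickle n)) (nested_lt s n).
Qed.

(** While [s] and [t] agree, the intervals coincide; at a first disagreement the midpoint of the
    common interval lies in one cut and not in the other. *)
Lemma cut_of_inj : injective cut_of.
Proof.
move=> s t st.
suff H n : nested s n = nested t n -> s n = t n.
  have E n : nested s n = nested t n by elim: n => //= n IHn; rewrite IHn (H _ IHn).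
  by apply/funext => n; exact: H (E n).
wlog [sn tn] : s t st / s n = false /\ t n = true.
  move=> W E; case sn : (s n); case tn : (t n) => //.
    by have := W t s (esym st) (conj tn sn) (esym E); rewrite sn tn.
  by have := W s t st (conj sn tn) E; rewrite sn tn.
move=> E; exfalso; pose m := ((nested s n).1 + (nested s n).2) / 2%:R.
have [_ _ _ _] := subintervalP (s n) (odflt 0 (unpickle n)) (nested_lt s n).
rewrite sn => sm.
have [_ _ _ _] := subintervalP (t n) (odflt 0 (unpickle n)) (nested_lt t n).
rewrite tn -E => tm.
have : ~ cut_of s m by apply/cut_ofPn; exists n.+1; rewrite /= sn.
by apply; rewrite st; exists n.+1; rewrite /= tn -E.
Qed.

End IrrationalCuts.

(** * Back-and-forth construction of a monotone surjection with a prescribed cut *)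

Section BackAndForth.
Local Open Scope classical_set_scope.
Local Open Scope order_scope.

Lemma seq_max d (U : orderType d) (x : U) (s : seq U) :
  exists2 m, m \in x :: s & forall y, y \in x :: s -> y <= m.
Proof.
elim: s x => [|z s IHs] x; first by exists x => [|y]; rewrite inE // => /eqP->.
have [m ms mP] := IHs (Order.max x z).
exists m => [|y].
  move: ms; rewrite inE => /predU1P[->|ms]; last by rewrite !inE ms !orbT.
  by rewrite /Order.max; case: ifP; rewrite !inE eqxx ?orbT.
have := mP _ (mem_head _ _); rewrite ge_max => /andP[xm zm].
rewrite !inE => /or3P[/eqP->|/eqP->|ys] //.
by apply: mP; rewrite inE ys orbT.
Qed.

Lemma seq_min d (U : orderType d) (x : U) (s : seq U) :
  exists2 m, m \in x :: s & forall y, y \in x :: s -> m <= y.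
Proof. exact: (@seq_max _ U^d x s). Qed.

Variables (d : Order.disp_t) (U : orderType d) (X : set U) (C : set rat) (a b : U).
Hypotheses (Xcount : countable X) (Ccut : irrational_cut C).
Hypotheses (Xa : X a) (Xb : X b) (ab : a < b).

(** Finite approximations of the surjection. The second clause, applied in both directions to equal
    first components, also makes [S] single-valued. *)
Definition coherent (S : seq (rat * U)) :=
  (forall q x, (q, x) \in S -> X x /\ (x <= a <-> C q)) /\
  (forall q x q' x', (q, x) \in S -> (q', x') \in S -> q <= q' -> x <= x').

Lemma coherent_cons S q x : coherent S -> X x -> (x <= a <-> C q) ->
  (forall q' x', (q', x') \in S -> q' <= q -> x' <= x) ->
  (forall q' x', (q', x') \in S -> q <= q' -> x <= x') ->
  coherent ((q, x) :: S).
Proof.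
move=> [S1 S2] Xx xa lo hi; split=> [q1 x1|q1 x1 q2 x2]; rewrite !inE !xpair_eqE.
  by move=> /orP[/andP[/eqP-> /eqP->]|/S1].
move=> /orP[/andP[/eqP-> /eqP->]|s1] /orP[/andP[/eqP-> /eqP->]|s2] //.
- exact: hi.
- exact: lo.
- exact: S2.
Qed.

Lemma extend_domain S q : coherent S -> exists x, coherent ((q, x) :: S).
Proof.
move=> cS; have [S1 S2] := cS.
pose L := [seq p.2 | p <- S & p.1 <= q]; pose G := [seq p.2 | p <- S & q <= p.1].
have LP x : reflect (exists2 p, (p, x) \in S & p <= q) (x \in L).
  apply: (iffP mapP) => [[[p y]]|[p pS pq]]; last by exists (p, x); rewrite ?mem_filter ?pq.
  by rewrite mem_filter => /andP[/= pq pS] ->; exists p.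
have GP x : reflect (exists2 p, (p, x) \in S & q <= p) (x \in G).
  apply: (iffP mapP) => [[[p y]]|[p pS pq]]; last by exists (p, x); rewrite ?mem_filter ?pq.
  by rewrite mem_filter => /andP[/= pq pS] ->; exists p.
have [C0 _ Cdown _ _] := Ccut.
(* The default value [x0] lies on the correct side of [a]. It is then clamped between the values [L]
   taken to the left of [q] and the values [G] taken to the right; old values may be reused, as the
   map need only be monotone. *)
have [x0 [Xx0 Cx0]] : exists x0, X x0 /\ ((C q /\ x0 = a) \/ (~ C q /\ a < x0)).
  by have [Cq|Cq] := pselect (C q); [exists a|exists b]; tauto.
have [m mL mP] := seq_max x0 L; have [x xG xP] := seq_min m G.
have Xm : X m by move: mL; rewrite inE => /predU1P[->//|/LP[p /S1[]]].
have xm : x <= m by apply: xP; rewrite mem_head.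
have x0m : x0 <= m by apply: mP; rewrite mem_head.
exists x; apply: coherent_cons => //.
- by move: xG; rewrite inE => /predU1P[->//|/GP[p /S1[]]].
- case: Cx0 => [[Cq x0E]|[Cq ax0]]; split=> // xa.
    apply: le_trans xm _; move: mL; rewrite inE => /predU1P[->|/LP[p /S1[_ pC] pq]].
      by rewrite x0E.
    by apply/pC; apply: Cdown Cq.
  move: xG; rewrite inE => /predU1P[xE|/GP[p /S1[_ pC] pq]].
    by have := lt_le_trans ax0 x0m; rewrite -xE ltNge xa.
  by apply: Cdown pq _; apply/pC.
- move=> q' x' S' q'q; move: xG; rewrite inE => /predU1P[->|/GP[p pS qp]].
    by apply: mP; rewrite inE; apply/orP; right; apply/LP; exists q'.
  by apply: S2 S' pS _; exact: le_trans qp.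
- by move=> q' x' S' qq'; apply: xP; rewrite inE; apply/orP; right; apply/GP; exists q'.
Qed.

Lemma rat_between (l g : rat) : l < g -> exists2 q, l < q & q < g.
Proof. by move=> lg; exists ((l + g) / 2%:R)%R; lra. Qed.

(** The new [q] is placed strictly between the rationals with value below [x] and those with value
    above [x], on the side of the cut dictated by [x]. *)
Lemma extend_range S x : X x -> coherent S -> exists q, coherent ((q, x) :: S).
Proof.
move=> Xx cS; have [S1 S2] := cS.
pose L := [seq p.1 | p <- S & p.2 < x]; pose G := [seq p.1 | p <- S & x < p.2].
have LP q : reflect (exists2 y, (q, y) \in S & y < x) (q \in L).
  apply: (iffP mapP) => [[[p y]]|[y yS yx]]; last by exists (q, y); rewrite ?mem_filter ?yx.
  by rewrite mem_filter => /andP[/= pq pS] ->; exists y.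
have GP q : reflect (exists2 y, (q, y) \in S & x < y) (q \in G).
  apply: (iffP mapP) => [[[p y]]|[y yS yx]]; last by exists (q, y); rewrite ?mem_filter ?yx.
  by rewrite mem_filter => /andP[/= pq pS] ->; exists y.
have LG l g : l \in L -> g \in G -> l < g.
  move=> /LP[y yS yx] /GP[z zS xz]; rewrite ltNge; apply/negP => gl.
  by have := le_lt_trans (S2 _ _ _ _ zS yS gl) (lt_trans yx xz); rewrite ltxx.
have [C0 [u Cu] Cdown Cmax Cmin] := Ccut.
suff [q [Cq lo hi]] : exists q, [/\ x <= a <-> C q,
    forall l, l \in L -> l < q & forall g, g \in G -> q < g].
  exists q; apply: coherent_cons => // q' x' S' qq'; rewrite leNgt; apply/negP => xx'.
    by have := hi q'; rewrite ltNge qq'; case/(_ _)/negP=> //; apply/GP; exists x'.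
  by have := lo q'; rewrite ltNge qq'; case/(_ _)/negP=> //; apply/LP; exists x'.
have [xa|ax] := leP x a.
  (* Here [L] and 0 lie in [C], which has no maximum, so some [c] in [C] exceeds them all; keeping
     [q] below [c] keeps it in [C]. The bound [g - 1] provides a lower end in case [L] is empty. *)
  have [m mL mP] := seq_max 0%R L.
  have Cm : C m.
    move: mL; rewrite inE => /predU1P[->//|/LP[y /S1[_ <-]] yx].
    exact: le_trans (ltW yx) xa.
  have [c mc Cc] := Cmax m Cm; have [g gG gP] := seq_min c G.
  have [l lL lP] := seq_max (g - 1)%R L.
  have [q lq qg] : exists2 q, l < q & q < g.
    apply: rat_between; move: lL; rewrite inE => /predU1P[->|lL]; first lra.
    move: gG; rewrite inE => /predU1P[->|]; last exact: LG.
    by apply: le_lt_trans mc; apply: mP; rewrite inE lL orbT.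
  exists q; split.
  - by split=> // _; apply: Cdown Cc; apply: le_trans (ltW qg) _; apply: gP; rewrite mem_head.
  - by move=> l' l'L; apply: le_lt_trans lq; apply: lP; rewrite inE l'L orbT.
  - by move=> g' g'G; apply: lt_le_trans qg _; apply: gP; rewrite inE g'G orbT.
(* The mirror image: [G] and [u] lie outside [C], and [q] is kept above a smaller point outside
   [C]. *)
have [m mG mP] := seq_min u G.
have Cm : ~ C m.
  move: mG; rewrite inE => /predU1P[->//|/GP[y /S1[_ <-]] yx].
  by apply/negP; rewrite -ltNge; exact: lt_trans yx.
have [c cm Cc] := Cmin m Cm; have [l lL lP] := seq_max c L.
have [g gG gP] := seq_min (l + 1)%R G.
have [q lq qg] : exists2 q, l < q & q < g.
  apply: rat_between; move: gG; rewrite inE => /predU1P[->|gG]; first lra.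
  move: lL; rewrite inE => /predU1P[->|lL]; last exact: LG.
  by apply: lt_le_trans cm _; apply: mP; rewrite inE gG orbT.
exists q; split.
- split=> // Cq; case: Cc; apply: Cdown Cq; apply: le_trans (ltW lq).
  by apply: lP; rewrite mem_head.
- by move=> l' l'L; apply: le_lt_trans lq; apply: lP; rewrite inE l'L orbT.
- by move=> g' g'G; apply: lt_le_trans qg _; apply: gP; rewrite inE g'G orbT.
Qed.

Lemma cut_surjection : exists r : rat -> U,
  [/\ {homo r : p q / p <= q}, r 0%R = a, forall q, X (r q),
      forall x, X x -> exists q, r q = x & forall q, r q <= a <-> C q].
Proof.
have /countable_injP[f f_inj] := Xcount.
(* Stage [n] serves both the rational with code [n] (0 if there is none) and the point of [X] with
   code [n], if any. Guarding by coherence makes the step total, so that choice applies. *)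
have /choice[F FP] (p : nat * seq (rat * U)) : exists S, coherent p.2 ->
    [/\ coherent S, {subset p.2 <= S},
      exists x, (odflt 0%R (unpickle p.1), x) \in S &
      forall x, X x -> f x = p.1 -> exists q, (q, x) \in S].
  case: p => n S /=.
  have [cS|] := pselect (coherent S); last by exists S.
  have [y cS1] := extend_domain (odflt 0%R (unpickle n)) cS.
  have [[x [Xx fx]]|nx] := pselect (exists x, X x /\ f x = n).
    have [q cS2] := extend_range Xx cS1.
    exists [:: (q, x), (odflt 0%R (unpickle n), y) & S] => _; split=> //.
    - by move=> p pS; rewrite !inE pS !orbT.
    - by exists y; rewrite !inE eqxx orbT.
    - move=> x' Xx' fx'; exists q; rewrite (f_inj x' x) ?mem_head ?inE //.
      by rewrite fx'.
  exists ((odflt 0%R (unpickle n), y) :: S) => _; split=> //.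
  - by move=> p pS; rewrite !inE pS !orbT.
  - by exists y; rewrite mem_head.
  - by move=> x Xx fx; case: nx; exists x.
pose St := fix St n := if n is m.+1 then F (m, St m) else [:: (0%R, a)].
have cSt n : coherent (St n).
  elim: n => [|n IHn] /=; last by have [] := FP (n, St n) IHn.
  have [C0 _ _ _ _] := Ccut.
  split=> [q x|q x q' x']; rewrite !inE !xpair_eqE; first by case/andP=> /eqP-> /eqP->; split.
  by case/andP=> _ /eqP-> /andP[_ /eqP->].
have sub m n : (m <= n)%N -> {subset St m <= St n}.
  elim: n => [|n IHn]; first by rewrite leqn0 => /eqP->.
  rewrite leq_eqVlt => /predU1P[->//|/IHn mn] p /mn pn.
  by have [_ /(_ p pn)] := FP (n, St n) (cSt n).
have /choice[r rP] q : exists x, exists n, (q, x) \in St n.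
  have [_ _ [x xS] _] := FP (pickle q, St (pickle q)) (cSt _).
  by exists x; exists (pickle q).+1; move: xS; rewrite /= pickleK.
have mono q x q' x' n n' : (q, x) \in St n -> (q', x') \in St n' -> q <= q' -> x <= x'.
  move=> /(sub _ _ (leq_maxl n n')) s /(sub _ _ (leq_maxr n n')) s'.
  by have [_] := cSt (maxn n n'); apply.
have uniq_r q x n : (q, x) \in St n -> r q = x.
  have [m rm] := rP q => xn.
  by apply/eqP; rewrite eq_le (mono _ _ _ _ _ _ rm xn) // (mono _ _ _ _ _ _ xn rm).
exists r; split.
- by move=> p q; have [m rm] := rP p; have [n rn] := rP q; exact: mono rm rn.
- by apply: (@uniq_r _ _ 0%N); rewrite mem_head.
- by move=> q; have [n rn] := rP q; have [/(_ _ _ rn)[]] := cSt n.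
- move=> x Xx; have [_ _ _ /(_ x Xx erefl)[q qx]] := FP (f x, St (f x)) (cSt _).
  by exists q; exact: (@uniq_r _ _ (f x).+1).
- by move=> q; have [n rn] := rP q; have [/(_ _ _ rn)[]] := cSt n.
Qed.

End BackAndForth.

(** * Splittings of idempotents through ordered sets *)

Section Splittings.
Local Open Scope classical_set_scope.
Local Open Scope order_scope.
Local Open Scope group_scope.
Let M : monoidType := {omorphism rat -> rat}.
Implicit Types (e f : M).

Lemma endo_le e p q : p <= q -> e p <= e q.
Proof. exact: omorph_le. Qed.

Lemma omorphism_of (f : rat -> rat) : {homo f : p q / p <= q} -> exists g : M, g =1 f.
Proof.
move=> fh.
pose g : {omorphism rat -> rat} := HB.pack f (Order.isOrderMorphism.Build _ _ _ _ f fh).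
by exists g.
Qed.

(** The idempotent [e] is factored through [X], which is thus a copy of its image. As [X] is a
    subset of an order, both [range e] and the orders constructed later fit. *)
Definition splitting d (U : orderType d) (X : set U) e (r : rat -> U) (s : U -> rat) :=
  [/\ {homo r : p q / p <= q}, forall x y, X x -> X y -> x <= y -> s x <= s y,
      forall q, X (r q), forall x, X x -> r (s x) = x & forall q, s (r q) = e q].

Definition splits d (U : orderType d) (X : set U) e := exists r s, splitting X e r s.

Lemma splits_idem d (U : orderType d) (X : set U) e : splits X e -> e * e = e.
Proof.
move=> [r [s [_ _ Xr rs sr]]]; apply: omorphism_ext => q.
by rewrite -[LHS]sr -[e q]sr rs.
Qed.

Lemma idem_splits_range e : e * e = e -> splits (range e) e.
Proof.
move=> ee; exists e, id; split=> //; first exact: endo_le.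
by move=> _ [q _ <-]; exact: (congr1 (fun f : M => f q) ee).
Qed.

(** Retracting onto [X] along one splitting and including along the other gives the two mutually
    inverse elements. *)
Lemma splits_greenD d (U : orderType d) (X : set U) e e' :
  splits X e -> splits X e' -> greenD e e'.
Proof.
move=> Se Se'; apply/greenD_idemP; [exact: splits_idem Se | exact: splits_idem Se' |].
have [r [s [rh sh Xr rs sr]]] := Se; have [r' [s' [rh' sh' Xr' rs' sr']]] := Se'.
have [x xE] : exists x : M, x =1 s' \o r.
  by apply: omorphism_of => p q pq; apply: sh' => //; exact: rh.
have [y yE] : exists y : M, y =1 s \o r'.
  by apply: omorphism_of => p q pq; apply: sh => //; exact: rh'.
exists x, y; split; apply: omorphism_ext => q.
- by rewrite -[RHS]sr -[LHS]/(y (x q)) xE yE /= rs'.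
- by rewrite -[RHS]sr' -[LHS]/(x (y q)) xE yE /= rs.
- by rewrite -[LHS]/(x (e q)) !xE /= -sr rs.
- by rewrite -[LHS]/(e (y q)) -sr !yE /= rs.
Qed.

Lemma greenD_splits d (U : orderType d) (X : set U) e e' :
  e' * e' = e' -> greenD e e' -> splits X e -> splits X e'.
Proof.
move=> ee' De Se; have ee := splits_idem Se.
have [x [y [xy yx ex ye]]] := (greenD_idemP ee ee').1 De.
have [r [s [rh sh Xr rs sr]]] := Se.
exists (r \o y), (x \o s); split=> //=.
- by move=> p q pq; apply: rh; exact: endo_le.
- by move=> u v Xu Xv uv; apply: endo_le; exact: sh.
- move=> u Xu; rewrite -[y _]/((x * y : M) (s u)) xy -sr !rs //.
- by move=> q; rewrite sr -[x _]/((y * e * x : M) q) -mulgA ex yx.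
Qed.

Lemma cut_splitting d (U : orderType d) (X : set U) (C : set rat) a b :
  countable X -> irrational_cut C -> X a -> X b -> a < b ->
  exists e, splits X e /\ forall q, e q <= 0%R <-> C q.
Proof.
move=> Xc Cc Xa Xb ab; have [r [rh r0 Xr rX rC]] := cut_surjection Xc Cc Xa Xb ab.
(* Elsewhere any preimage will do, since a section of a monotone map is monotone. Sending [a] to 0
   makes [e q <= 0] equivalent to [r q <= a]. *)
pose s x := if x == a then 0%R else xget 0%R [set q | r q = x].
have rs x : X x -> r (s x) = x.
  rewrite /s; case: eqP => [->//|_ /rX xr]; exact: (@xgetPex _ _ [set q | r q = x]).
have sh x y : X x -> X y -> x <= y -> s x <= s y.
  move=> Xx Xy xy; rewrite leNgt; apply/negP => yx.
  have := rh _ _ (ltW yx); rewrite !rs // => yx'.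
  have xyE : x = y by apply/le_anti; rewrite xy yx'.
  by rewrite xyE ltxx in yx.
have [e eE] : exists e : M, e =1 s \o r.
  by apply: omorphism_of => p q pq; apply: sh => //; exact: rh.
exists e; split; first by exists r, s; split.
have sa : s a = 0%R by rewrite /s eqxx.
move=> q; rewrite eE -rC -sa /=; split=> [sq|]; last exact: sh.
by have := rh _ _ sq; rewrite !rs.
Qed.

(** The two values of [e] supply the points [a < b] of its range. Since the cut can be read off from
    [e'], different [s] yield different idempotents in the D-class of [e]. *)
Lemma greenD_cut e p q s : e * e = e -> e p != e q ->
  exists e', [/\ e' * e' = e', greenD e e' & forall q, e' q <= 0%R <-> cut_of s q].
Proof.
move=> ee; wlog epq : p q / e p < e q => [W|_].
  by move=> pq; case/orP: (lt_total pq) => lt; [apply: (W p q) | apply: (W q p)];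
    rewrite // eq_sym.
have Xc : countable (range e) by exact: countableP.
have [] := @cut_splitting _ _ _ _ (e p) (e q) Xc (cut_of_irrational s) _ _ epq.
- by exists p.
- by exists q.
move=> e' [Se' e'C]; exists e'; split=> //; first exact: splits_idem Se'.
exact: splits_greenD (idem_splits_range ee) Se'.
Qed.

End Splittings.

(** * Sets of the size of the continuum *)

Section Cardinality.
Local Open Scope classical_set_scope.
Local Open Scope card_scope.

Lemma card_eq_sequences T (A : set T) (f : T -> nat -> bool) (g : (nat -> bool) -> T) :
  {in A &, injective f} -> (forall s, A (g s)) -> injective g ->
  A #= [set: nat -> bool].
Proof.
move=> f_inj Ag g_inj; apply: Cantor_Bernstein.
  by apply/pcard_injP; exists f.
have [h] : $|{injfun [set: nat -> bool] >-> A}|.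
  by apply/injfunPex; exists g => [s _|s t _ _]; [exact: Ag | exact: g_inj].
exact: inj_card_le h.
Qed.

Lemma uncountable_sequences : ~ countable [set: nat -> bool].
Proof.
move=> /countable_injP[f f_inj].
(* Cantor's diagonal sequence: at [f t] it negates the value of [t]. *)
pose s n := ~~ `[< exists t : nat -> bool, f t = n /\ t n >].
have [sf|sf] := boolP (s (f s)).
  by have /negP := sf; apply; apply/asboolP; exists s.
move: (sf); rewrite /s negbK => /asboolP[t [ft tfs]].
by move: tfs; rewrite (f_inj t s) ?inE // (negbTE sf).
Qed.

End Cardinality.

(** * The class of constant maps and the other regular D-classes *)

Section RegularClasses.
Local Open Scope classical_set_scope.
Local Open Scope card_scope.
Local Open Scope group_scope.
Let M : monoidType := {omorphism rat -> rat}.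
Implicit Types (e f g : M) (D H : set M).

(** A map is coded by the characteristic sequence of its graph; this gives all the upper bounds on
    cardinalities. *)
Lemma endo_code : exists c : M -> nat -> bool, injective c.
Proof.
exists (fun f n => if unpickle n is Some (p, q) then f p == q else false) => f g fg.
apply: omorphism_ext => p; apply/eqP.
by have := congr1 (@^~ (pickle (p, g p))) fg; rewrite pickleK eqxx.
Qed.

Lemma constant_endo q : exists f : M, f =1 cst q.
Proof. exact: omorphism_of. Qed.

Lemma range_card1 f : range f #= `I_1 <-> exists q, f =1 cst q.
Proof.
split=> [/card_set_bijP[h [hf h_inj _]]|[q fq]].
  exists (f 0%R) => p; have fr r : range f (f r) by exists r.
  have h0 r : h (f r) = 0%N by move: (hf _ (fr r)); rewrite /= ltnS leqn0 => /eqP.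
  by apply: h_inj; rewrite ?inE ?h0.
suff -> : range f = [set q] by exact: card_set1.
by apply/seteqP; split=> [_ [p _ <-]|_ ->]; [exact: fq | exists 0%R => //; exact: fq].
Qed.

(** Left multiples precompose, which does not change a constant map, so L-classes of constants are
    singletons. Right multiples postcompose and can turn it into any other constant. *)
Lemma constant_greenL f g q : f =1 cst q -> greenL f g -> f = g.
Proof.
move=> fq /greenLP[_ [b ->]]; apply: omorphism_ext => p.
by rewrite -[RHS]/(f (b p)) !fq.
Qed.

Lemma constant_greenR f g q q' : f =1 cst q -> g =1 cst q' -> greenR f g.
Proof.
move=> fq gq; have [a aE] := constant_endo q; have [b bE] := constant_endo q'.
apply/greenRP; split; [exists a | exists b]; apply: omorphism_ext => p.
  by rewrite fq -[RHS]/(a (g p)) aE.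
by rewrite gq -[RHS]/(b (f p)) bE.
Qed.

Lemma constant_greenD f g q : f =1 cst q -> greenD f g <-> exists q', g =1 cst q'.
Proof.
move=> fq; split=> [[h [/(constant_greenL fq) <- /greenRP[_ [b ->]]]]|[q' gq]].
  by exists (b q) => p; rewrite -[LHS]/(b (f p)) fq.
by exists f; split=> //; exact: constant_greenR fq gq.
Qed.

Definition constants : set M := [set f | range f #= `I_1].

Lemma constantsE f : constants f -> constants = [set g | greenD f g].
Proof.
move=> /range_card1[q fq]; apply/seteqP.
by split=> g; rewrite /constants /= range_card1 (constant_greenD _ fq).
Qed.

Lemma constants_idem f : constants f -> f * f = f.
Proof.
move=> /range_card1[q fq]; apply: omorphism_ext => p.
by rewrite -[LHS]/(f (f p)) !fq.
Qed.

Lemma regular_constants : regular_Dclass constants.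
Proof.
have [f fq] := constant_endo 0%R.
have Cf : constants f by apply/range_card1; exists 0%R.
split; first by exists f; exact: constantsE.
by exists f => //; exists f; rewrite !constants_idem.
Qed.

Lemma countable_constants : countable constants.
Proof.
apply/countable_injP; exists (fun f => pickle (f 0%R)) => f g.
rewrite !inE => /range_card1[q fq] /range_card1[q' gq] /(pcan_inj pickleK).
by move=> fg0; apply: omorphism_ext => p; rewrite [LHS]fq [RHS]gq; move: fg0; rewrite fq gq.
Qed.

Lemma Hclass_constants H : Hclass H -> H `<=` constants ->
  group_Hclass H /\ isomorphic_to H unit.
Proof.
move=> [f HE] Hc; have Hf : H f by rewrite HE.
have /range_card1[q fq] := Hc f Hf; have ff := constants_idem (Hc f Hf).
split; first by exists f.
have H1 : H = [set f].
  rewrite HE; apply/seteqP; split=> [g [fg _]|_ ->] //.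
  by rewrite /= -(constant_greenL fq fg).
pose phi (_ : unit) := f.
have phiM : {morph phi : x y / x * y >-> x * y} by move=> x y; rewrite /phi ff.
pose psi : {multiplicative unit -> M} :=
  HB.pack phi (isMultiplicative.Build _ _ phi phiM).
exists psi; rewrite H1; split=> //.
- by move=> [] [].
- by move=> _ ->; exists tt.
Qed.

Lemma card_group_Hclasses D : regular_Dclass D -> D <> constants ->
  [set H | group_Hclass H /\ H `<=` D] #= [set: nat -> bool].
Proof.
move=> Dreg Dc; have [e [De ee DE]] := regular_Dclass_idem Dreg.
have [p [q epq]] : exists p q, e p != e q.
  apply: contrapT => np; apply: Dc; rewrite DE; apply/esym/constantsE/range_card1.
  exists (e 0%R) => p; apply/eqP/negPn/negP => pq.
  by apply: np; exists p, 0%R.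
have /choice[E EP] s := greenD_cut s ee epq.
have [c c_inj] := endo_code.
(* A group H-class is coded through a chosen idempotent that determines it; other sets receive a
   dummy sequence. *)
pose F H := if pselect (exists e, e * e = e /\ H = [set g | greenH e g]) is left P
  then c (projT1 (cid P)) else fun=> false.
apply: (@card_eq_sequences _ _ F (fun s => [set g | greenH (E s) g])).
- have FP H : group_Hclass H -> exists2 e, H = [set g | greenH e g] & F H = c e.
    move=> [e' e'e' HE]; rewrite /F; case: pselect => [P|[]]; last by exists e'.
    by case: cid => /= e1 [_ HE1]; exists e1.
  move=> H K; rewrite !inE => -[/FP[e1 HE ->] _] [/FP[e2 KE ->] _] /c_inj e12.
  by rewrite HE KE e12.
- move=> s; have [Ei De' _] := EP s; split; first by exists (E s).
  by apply: Hclass_subset; [case: Dreg | rewrite DE].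
- move=> s t st; have [Es _ Cs] := EP s; have [Et _ Ct] := EP t.
  have : [set g | greenH (E s) g] (E t) by rewrite st.
  move=> /(greenH_idem_eq Es Et) Est; apply: cut_of_inj; apply/seteqP.
  by split=> r; rewrite -Cs -Ct Est.
Qed.

(** An H-class is determined by any of its elements, so a countable [D] has only countably many,
    against the count for non-constant classes. *)
Lemma countable_regular_Dclass D : regular_Dclass D -> countable D -> D = constants.
Proof.
move=> Dreg /countable_injP[f f_inj]; apply: contrapT => /(card_group_Hclasses Dreg) cD.
apply: uncountable_sequences; rewrite -(eq_countable cD).
have [c c_inj] := endo_code.
apply/countable_injP.
pose G H := if pselect (exists e, H e) is left P then f (projT1 (cid P)) else 0%N.
exists G.
have GP H : group_Hclass H -> exists2 e, H e & G H = f e.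
  move=> [e ee HE]; rewrite /G; case: pselect => [P|[]]; last by exists e; rewrite HE.
  by case: cid => /= e1 He1; exists e1.
move=> H K; rewrite !inE => -[Hg HD] [Kg KD].
have [e He ->] := GP _ Hg; have [e' Ke ->] := GP _ Kg => /f_inj ee'.
have {}ee' := ee' (mem_set (HD _ He)) (mem_set (KD _ Ke)); rewrite {}ee' in He.
have HclassE L g : group_Hclass L -> L g -> L = [set h | greenH g h].
  by move=> [e1 _ ->] e1g; exact: Hclass_eq.
by rewrite (HclassE _ _ Hg He) (HclassE _ _ Kg Ke).
Qed.

End RegularClasses.

(** * Orders encoding a binary sequence, and their isomorphisms *)

Section ExtendedOrder.
Local Open Scope classical_set_scope.
Local Open Scope order_scope.
Variables (d : Order.disp_t) (Omega : orderType d) (w0 : Omega).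

Let U := (rat *l (Omega *l nat))%type.
Implicit Types (s t : nat -> bool) (x y : U) (q : rat) (w : Omega) (i : nat).

(** Halving recovers [q] and parity recovers the bit, even when blocks for different sequences are
    compared. The block at -(n+1) carries the bit [s n], so the whole of [s] is recorded. *)
Definition block_last s q : nat := ((pickle q).*2 + s `|numq q|%N.-1)%N.

(* The points below 0 form finite blocks of pairwise distinct lengths, ordered
   like the negative rationals; above them each point of Omega is replaced by a
   copy of the natural numbers. *)
Definition extended s : set U :=
  [set x | x.1 = 0%R \/ [/\ (x.1 < 0)%R, x.2.1 = w0 & (x.2.2 <= block_last s x.1)%N]].

Definition next x : U := (x.1, (x.2.1, x.2.2.+1)).

Definition covers (X : set U) x y :=
  [/\ X x, X y, x < y & forall z, X z -> x < z -> ~ z < y].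

Definition order_iso (X Y : set U) (h k : U -> U) :=
  [/\ forall x, X x -> Y (h x) /\ k (h x) = x,
      forall x y, X x -> X y -> x <= y -> h x <= h y,
      forall y, Y y -> X (k y) /\ h (k y) = y
    & forall x y, Y x -> Y y -> x <= y -> k x <= k y].

Lemma order_iso_sym (X Y : set U) h k : order_iso X Y h k -> order_iso Y X k h.
Proof. by case. Qed.

Lemma order_iso_lt (X Y : set U) h k x y : order_iso X Y h k ->
  X x -> X y -> x < y -> h x < h y.
Proof.
move=> [hX h_mono kY k_mono] Xx Xy xy; rewrite ltNge; apply/negP => hyx.
have [[Yhx kx] [Yhy ky]] := (hX x Xx, hX y Xy).
by have := k_mono _ _ Yhy Yhx hyx; rewrite kx ky leNgt xy.
Qed.

Lemma covers_iso (X Y : set U) h k x y : order_iso X Y h k ->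
  covers X x y -> covers Y (h x) (h y).
Proof.
move=> hk [Xx Xy xy none]; have [hX _ kY _] := hk.
split; [exact: (hX x Xx).1 | exact: (hX y Xy).1 | exact: order_iso_lt hk _ _ _ |].
move=> z Yz xz zy; have [Xkz hkz] := kY z Yz; have kh := order_iso_sym hk.
apply: (none _ Xkz).
  by have := order_iso_lt kh (hX x Xx).1 Yz xz; rewrite (hX x Xx).2.
by have := order_iso_lt kh Yz (hX y Xy).1 zy; rewrite (hX y Xy).2.
Qed.

Lemma ltUE q w i q' w' i' : ((q, (w, i)) : U) < (q', (w', i')) =
  (q < q')%R || (q == q') && ((w < w') || (w == w') && (i < i')%N).
Proof.
rewrite !ltxi_pair.
case: (ltgtP q q') => //= _; case: (ltgtP w w') => //= _.
Qed.

Lemma leUE q w q' w' : ((q, (w, 0%N)) : U) <= (q', (w', 0%N)) =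
  (q < q')%R || (q == q') && (w <= w').
Proof.
rewrite !lexi_pair.
by case: (ltgtP q q') => //= _; case: (ltgtP w w').
Qed.

Lemma extended_pred s q w i : extended s (q, (w, i.+1)) -> extended s (q, (w, i)).
Proof. by move=> [/= ->|[/= q0 -> /ltnW iq]]; [left | right]. Qed.

(** Density of the negative rationals separates points of different blocks; over 0, a column of
    [Omega] has no last point, so nothing in a later column covers a point of it. *)
Lemma coversP s x y : covers (extended s) x y <-> extended s y /\ y = next x.
Proof.
case: x => q [w i]; case: y => q' [w' i']; split; last first.
  rewrite /next /= => -[Xy [qE wE iE]]; move: Xy; rewrite {q'}qE {w'}wE {i'}iE => Xy.
  split=> //; first exact: extended_pred Xy.
    by rewrite ltUE !ltxx !eqxx /= ltnSn.
  case=> p [u j] _; rewrite !ltUE.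
  case: (ltgtP q p) => //= _; case: (ltgtP w u) => //= _; lia.
move=> [Xx Xy xy none]; split=> //; move: (xy); rewrite ltUE => /orP[qq'|].
  have q0 : (q < 0)%R by case: Xy => [/=<-//|[/= q'0 _ _]]; exact: lt_trans q'0.
  have [p qp pq'] := rat_between qq'.
  have p0 : (p < 0)%R.
    by case: Xy => [/= q'0|[/= q'0 _ _]]; [rewrite -q'0 | exact: lt_trans q'0].
  by case: (none (p, (w0, 0%N))); [right | rewrite ltUE qp | rewrite ltUE pq'].
move=> /andP[/eqP qE /orP[ww'|/andP[/eqP wE ii']]].
  have q0 : q = 0%R.
    case: Xx => //= -[/= q0 wE _]; case: Xy => [/= q'0|[/= _ w'E _]]; first by rewrite qE.
    by move: ww'; rewrite wE w'E ltxx.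
  case: (none (q, (w, i.+1))); first by left.
    by rewrite ltUE !ltxx !eqxx /= ltnSn.
  by rewrite ltUE qE ltxx eqxx ww'.
subst q' w'; move: ii'; rewrite leq_eqVlt => /predU1P[<-//|ii'].
case: (none (q, (w, i.+1))).
- by case: Xy => [|[/= q0 wE /(leq_trans (ltnW ii'))]]; [left | right].
- by rewrite ltUE !ltxx !eqxx /= ltnSn.
- by rewrite ltUE !ltxx !eqxx.
Qed.

(** The bottom of a column is a point that covers nothing, so it goes to a bottom; covers go to
    covers, which settles the rest by induction. *)
Lemma iso_column s t h k q w : order_iso (extended s) (extended t) h k ->
  extended s (q, (w, 0%N)) ->
  exists q' w', forall i, extended s (q, (w, i)) -> h (q, (w, i)) = (q', (w', i)).
Proof.
move=> hk Xqw; have [hX _ kY _] := hk; have [Yh kh] := hX _ Xqw.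
case hE : (h (q, (w, 0%N))) => [q' [w' j]]; exists q', w'.
have j0 : j = 0%N.
  case: j hE => // j hE; rewrite hE in Yh kh.
  have : covers (extended t) (q', (w', j)) (q', (w', j.+1)) by apply/coversP.
  by move=> /(covers_iso (order_iso_sym hk)); rewrite kh => /coversP[_ []].
elim=> [_|i IHi Xi]; first by rewrite hE j0.
have : covers (extended s) (q, (w, i)) (q, (w, i.+1)) by apply/coversP.
by move=> /(covers_iso hk)/coversP[_ ->]; rewrite IHi //; exact: extended_pred Xi.
Qed.

Lemma iso_negative s t h k q : order_iso (extended s) (extended t) h k -> (q < 0)%R ->
  (forall i, extended s (q, (w0, i)) -> h (q, (w0, i)) = (q, (w0, i))) /\
  s `|numq q|%N.-1 = t `|numq q|%N.-1.
Proof.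
move=> hk q0; have Xq i : (i <= block_last s q)%N -> extended s (q, (w0, i)) by right.
have [q' [w' hE]] := iso_column hk (Xq 0%N isT).
have [hX _ kY _] := hk.
have [Y0 k0] := hX _ (Xq 0%N isT); rewrite hE in Y0 k0; last exact: Xq.
have [q'' [w'' kE]] := iso_column (order_iso_sym hk) Y0.
have [? ?] : q'' = q /\ w'' = w0 by move: k0; rewrite kE // => -[].
subst q'' w''.
case: (Y0) => /= [q'0|[q'0 /= w'E _]].
  (* A column over 0 is infinite, so pulling back its point of index one past the end of the block
     leads out of the block. *)
  have Y1 : extended t (q', (w', (block_last s q).+1)) by left.
  have [] := kY _ Y1; rewrite kE // => -[/= q00|[/= _ _]]; last by rewrite ltnn.
  by rewrite q00 ltxx in q0.
have le1 : (block_last s q <= block_last t q')%N.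
  have [] := hX _ (Xq _ (leqnn _)); rewrite hE; last exact: Xq.
  by move=> [/= q00|[]//]; rewrite q00 ltxx in q'0.
have le2 : (block_last t q' <= block_last s q)%N.
  have Y1 : extended t (q', (w', block_last t q')) by right.
  have [] := kY _ Y1; rewrite kE // => -[/= q00|[]//].
  by rewrite q00 ltxx in q0.
(* The block lengths agree, so halves and parities agree. *)
have [/(pcan_inj pickleK) qE st] :
    pickle q = pickle q' /\ s `|numq q|%N.-1 = t `|numq q'|%N.-1 :> bool.
  move: le1 le2; rewrite /block_last.
  by case: (s _); case: (t _) => /= le1 le2; split=> //; lia.
by subst q' w'.
Qed.

(** A column over 0 cannot land on a negative block, because the inverse isomorphism fixes such
    blocks. *)
Lemma iso_omega s t h k w : order_iso (extended s) (extended t) h k ->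
  exists w', forall i, h (0%R, (w, i)) = (0%R, (w', i)).
Proof.
move=> hk; have X0 i : extended s (0%R, (w, i)) by left.
have [q' [w' hE]] := iso_column hk (X0 0%N).
exists w' => i; rewrite hE //; have [hX _ kY _] := hk.
have [Y0 kh] := hX _ (X0 0%N); rewrite hE // in Y0 kh.
case: (Y0) => [/= ->//|[/= q'0 w'E _]]; rewrite w'E in Y0 kh.
have [kE _] := iso_negative (order_iso_sym hk) q'0.
by move: kh; rewrite kE // => -[q'E _]; rewrite q'E ltxx in q'0.
Qed.

Lemma extended_iso_inj s t h k : order_iso (extended s) (extended t) h k -> s = t.
Proof.
move=> hk; apply/funext => n.
(* The block at -(n+1) carries bit [n], because of the predecessor in [block_last]. *)
have q0 : ((- n.+1%:Z)%:~R < 0 :> rat)%R by rewrite ltrz0 oppr_lt0.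
by have [_] := iso_negative hk q0; rewrite numq_int abszN.
Qed.

Definition lift_aut (g : orderAut Omega) x : U :=
  if x.1 == 0%R then (x.1, (g x.2.1, x.2.2)) else x.

Lemma iso_lift_aut s h k : order_iso (extended s) (extended s) h k ->
  exists g, forall x, extended s x -> h x = lift_aut g x.
Proof.
move=> hk; have kh := order_iso_sym hk.
have /choice[g gE] w := iso_omega w hk; have /choice[f fE] w := iso_omega w kh.
have [hX h_mono kX k_mono] := hk; have X0 w : extended s (0%R, (w, 0%N)) by left.
have gK : cancel g f by move=> w; have [_] := hX _ (X0 w); rewrite gE fE => -[].
have fK : cancel f g by move=> w; have [_] := kX _ (X0 w); rewrite fE gE => -[].
have gm : {mono g : w w' / w <= w'}.
  move=> w w'; apply/idP/idP => ww'.
    have := k_mono _ _ (X0 (g w)) (X0 (g w')).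
    by rewrite !fE !leUE ltxx eqxx /= !gK; exact.
  have := h_mono _ _ (X0 w) (X0 w').
  by rewrite !gE !leUE ltxx eqxx /=; exact.
exists (OrderAut (Bijective gK fK) gm) => -[q [w i]] Xx; rewrite /lift_aut /=.
case: eqP => [->|q0]; first exact: gE.
case: (Xx) => [//|[/= qneg wE _]]; rewrite wE; rewrite /= wE in Xx.
by have [hE _] := iso_negative hk qneg; exact: hE.
Qed.

Lemma lift_aut_extended s g x : extended s x -> extended s (lift_aut g x).
Proof. by rewrite /lift_aut; case: eqP => // x0 _; left. Qed.

Lemma lift_aut_mono g x y : x <= y -> lift_aut g x <= lift_aut g y.
Proof.
case: x => q [w i]; case: y => q' [w' i']; rewrite /lift_aut /=.
have [->|q0] := eqVneq q 0%R; have [->|q'0] := eqVneq q' 0%R; rewrite !lexi_pair //.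
- by rewrite !orderAut_mono.
- by case: ltgtP q'0.
- by case: ltgtP q0.
Qed.

End ExtendedOrder.

(** * Continuum many D-classes with maximal subgroup Aut(Omega) *)

Section PrescribedGroups.
Local Open Scope classical_set_scope.
Local Open Scope card_scope.
Local Open Scope order_scope.
Local Open Scope group_scope.
Let M : monoidType := {omorphism rat -> rat}.
Implicit Types (e f : M) (D H : set M).
Variables (d : Order.disp_t) (Omega : orderType d) (w0 : Omega).
Hypothesis Omega_countable : countable [set: Omega].
Let U := (rat *l (Omega *l nat))%type.
Let X s : set U := extended w0 s.

Lemma splits_order_iso s t e : splits (X s) e -> splits (X t) e ->
  exists h k, order_iso (X s) (X t) h k.
Proof.
move=> [r [i [rh ih Xr ri ir]]] [r' [i' [rh' ih' Xr' ri' ir']]].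
exists (r' \o i), (r \o i'); split=> /=.
- by move=> x Xx; split=> //; rewrite ir' -ir !ri.
- by move=> x y Xx Xy xy; apply: rh'; exact: ih.
- by move=> x Xx; split=> //; rewrite ir -ir' !ri'.
- by move=> x y Xx Xy xy; apply: rh; exact: ih'.
Qed.

(** The splitting conjugates the units of [eMe] into automorphisms of [X s], and these are exactly
    the lifts of automorphisms of [Omega]. *)
Lemma Hclass_aut s e : splits (X s) e ->
  isomorphic_to [set f | greenH e f] (orderAut Omega).
Proof.
move=> Se; have ee := splits_idem Se; have [r [i [rh ih Xr ri ir]]] := Se.
have XL g x : X s x -> X s (lift_aut g x) by exact: lift_aut_extended.
have /choice[phi phiE] (g : orderAut Omega) :
    exists f : M, f =1 fun q => i (lift_aut g (r q)).
  apply: omorphism_of => p q pq; apply: ih; try exact: XL.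
  by apply: lift_aut_mono; exact: rh.
have LM (g g' : orderAut Omega) (x : U) :
    lift_aut (g * g') x = lift_aut g' (lift_aut g x).
  by rewrite /lift_aut; case: ifP => x0; rewrite ?x0.
have L1 (x : U) : lift_aut (1 : orderAut Omega) x = x.
  by rewrite /lift_aut; case: x => q [w j] /=; case: ifP.
have phiM : {morph phi : g g' / g * g' >-> g * g'}.
  move=> g g'; apply: omorphism_ext => q.
  rewrite -[RHS]/(phi g' (phi g q)) !phiE ri; last exact: XL.
  by rewrite LM.
have phi1 : phi 1 = e by apply: omorphism_ext => q; rewrite phiE L1 ir.
pose psi : {multiplicative orderAut Omega -> M} :=
  HB.pack phi (isMultiplicative.Build _ _ phi phiM).
exists psi; split.
- move=> g _; apply/(greenH_idemP _ ee).
  rewrite -phi1 /psi /= -!phiM mul1g mulg1; split=> //.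
  by exists (phi g^-1); rewrite -!phiM mulgV mulVg.
- move=> g g' _ _ gg'; apply: orderAut_ext => w.
  (* The bottom of the column of [w] over 0 reveals the value of the automorphism at [w]. *)
  have X0 : X s (0%R, (w, 0%N)) by left.
  have E : r (phi g (i (0%R, (w, 0%N)))) = r (phi g' (i (0%R, (w, 0%N)))).
    by rewrite [phi g]gg'.
  move: E; rewrite !phiE !ri //; try exact: XL.
  by rewrite /lift_aut /= => -[].
move=> f /(greenH_idemP _ ee)[ef fe [f' [ff' f'f]]].
(* For surjectivity, [f] is transported to [X s], with its inverse [f'] giving the inverse
   isomorphism. *)
have hk : order_iso (X s) (X s) (r \o f \o i) (r \o f' \o i).
  have endo_mono (f1 : M) x y : X s x -> X s y -> x <= y -> r (f1 (i x)) <= r (f1 (i y)).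
    by move=> Xx Xy xy; apply/rh/endo_le/ih.
  split=> /=; do ?[exact: endo_mono]; move=> x Xx; split=> //.
    by rewrite ir -[f' _]/((f * e * f' : M) (i x)) fe ff' -ir !ri.
  by rewrite ir -[f _]/((f' * e * f : M) (i x)) -mulgA ef f'f -ir !ri.
have [g gE] := iso_lift_aut hk; exists g => //; apply: omorphism_ext => q.
rewrite /psi /= phiE -gE; last exact: Xr.
by rewrite -[LHS]/(i (r (f (i (r q))))) !ir -[LHS]/((e * f * e : M) q) ef fe.
Qed.

Lemma card_Dclasses_aut :
  [set D : set M | regular_Dclass D /\
     forall H : set M, group_Hclass H -> H `<=` D ->
       isomorphic_to H (orderAut Omega)] #= [set: nat -> bool].
Proof.
have Xcount s : countable (X s).
  have /countable_injP[f f_inj] := Omega_countable.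
  apply/countable_injP; exists (fun x : U => pickle (x.1, (f x.2.1, x.2.2))).
  move=> [q [w i]] [q' [w' i']] _ _ /= /(pcan_inj pickleK)[-> fw ->].
  by rewrite (f_inj w w') ?inE.
have /choice[E EP] s : exists e, splits (X s) e.
  (* Only the existence of a splitting matters here: the cut is arbitrary, and the two points are
     any with the first below the second. *)
  have [||| e [Se _]] := @cut_splitting _ _ (X s) _ ((-1)%R, (w0, 0%N)) (0%R, (w0, 0%N))
    (Xcount s) (cut_of_irrational xpredT).
  - by right.
  - by left.
  - by rewrite ltUE.
  by exists e.
have Eidem s := splits_idem (EP s).
have [c c_inj] := endo_code.
pose F D := if pselect (exists e, D = [set f | greenD e f]) is left P
  then c (projT1 (cid P)) else fun=> false.
apply: (@card_eq_sequences _ _ F (fun s => [set f | greenD (E s) f])).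
- have FP D : Dclass D -> exists2 e, D = [set f | greenD e f] & F D = c e.
    move=> [e DE]; rewrite /F; case: pselect => [P|[]]; last by exists e.
    by case: cid => /= e1 DE1; exists e1.
  move=> D D'; rewrite !inE => -[[/FP[e1 DE ->] _] _] [[/FP[e2 DE' ->] _] _] /c_inj e12.
  by rewrite DE DE' e12.
- move=> s; split.
    split; first by exists (E s).
    by exists (E s); [exact: greenD_refl | exists 1; rewrite mulg1 Eidem].
  move=> _ [e ee ->] eD; apply: (@Hclass_aut s).
  by apply: greenD_splits ee _ (EP s); apply: eD.
(* If the D-classes coincide, one idempotent splits through both orders, which are then isomorphic
   and so encode the same sequence. *)
- move=> s t st.
  have : [set f | greenD (E s) f] (E t) by rewrite st; exact: greenD_refl.
  move=> /(greenD_splits (Eidem t))/(_ (EP s)) Sst.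
  by have [h [k]] := splits_order_iso Sst (EP t); exact: extended_iso_inj.
Qed.

End PrescribedGroups.

Local Open Scope classical_set_scope.
Local Open Scope card_scope.

Theorem theorem1 :
  let M : monoidType := {omorphism rat -> rat} in
  (forall (d : Order.disp_t) (Omega : orderType d),
     [set: Omega] !=set0 -> countable [set: Omega] ->
     [set D : set M | regular_Dclass D /\
        forall H : set M, group_Hclass H -> H `<=` D ->
          isomorphic_to H (orderAut Omega)] #= [set: nat -> bool])
  /\
  exists D0 : set M,
    [/\ [set D : set M | regular_Dclass D /\ countable D] = [set D0],
        D0 = [set f : M | range f #= `I_1],
        forall f : M, D0 f -> (f * f)%g = f,
        forall H : set M, Hclass H -> H `<=` D0 ->
          group_Hclass H /\ isomorphic_to H unit
      & forall D : set M, regular_Dclass D -> D <> D0 ->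
          [set H : set M | group_Hclass H /\ H `<=` D] #= [set: nat -> bool]].
Proof.
split=> [d Omega [w0 _] Omega_countable|]; first exact: card_Dclasses_aut w0 Omega_countable.
exists constants; split=> //.
- apply/seteqP; split=> [D [Dreg Dcount]|_ ->]; first exact: countable_regular_Dclass.
  by split; [exact: regular_constants | exact: countable_constants].
- exact: constants_idem.
- exact: Hclass_constants.
- exact: card_group_Hclasses.
Qed.
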